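(* Let $I=[0,1]$ or $I=[0,\infty)$, let $X$ be a Banach function space on $I$, let $w:I\to(0,\infty)$ be a measurable weight, and let $T=\mathcal H_w$ or $T=\mathcal H_w^*$. If the space $TX$ is nontrivial (i.e. $TX\ne\{0\}$), then $TX$ contains an order asymptotically isometric copy of $\ell^1$.
   Context: $L^0(I)$ is the space of (a.e. equivalence classes of) real-valued Lebesgue measurable functions on $I$. A Banach function space $X$ on $I$ is a Banach space that is a linear subspace of $L^0(I)$ with the ideal property: $|f|\le|g|$ a.e., $f\in L^0(I)$, $g\in X$ imply $f\in X$ and $\|f\|_X\le\|g\|_X$; by convention $X$ is also assumed to contain a function positive a.e. on $I$ (this is not assumed for the derived space $TX$). $\mathcal H_wf(x)=w(x)\int_0^xf(t)\,dt$ and $\mathcal H_w^*f(x)=\int_{I\cap[x,\infty)}w(t)f(t)\,dt$ for $x\in I$. $TX=\{f\in L^0(I): T|f|\in X\}$ with norm $\|f\|_{TX}=\|T|f|\|_X$. A space $E\subset L^0(I)$ with the ideal property and complete norm contains an order asymptotically isometric copy of $\ell^1$ if there are a sequence $(f_n)\subset E$ with pairwise disjoint supports and a sequence $(\varepsilon_n)\subset(0,1)$ with $\varepsilon_n\to0$ such that $\sum_{n=1}^\infty(1-\varepsilon_n)|\alpha_n|\le\left\|\sum_{n=1}^\infty\alpha_nf_n\right\|_E\le\sum_{n=1}^\infty|\alpha_n|$ for each $(\alpha_n)\in\ell^1$. *)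

(* Defs.v *)
From HB Require Import structures.
From mathcomp Require Import all_boot all_order all_algebra.
From mathcomp Require Import all_classical all_reals all_analysis.
From mathcomp Require Import measurable_realfun.
Import Order.TTheory GRing.Theory Num.Theory.
Import numFieldNormedType.Exports.

Set Implicit Arguments.
Unset Strict Implicit.
Unset Printing Implicit Defensive.

Local Open Scope classical_set_scope.
Local Open Scope ring_scope.

(* [lebR R] is the real line with the sigma-algebra of Lebesgue (not only
   Borel) measurable sets; it is the carrier of [completed_lebesgue_measure]. *)
Notation lebR R := (caratheodory_type ((wlength (R := R) idfun)^*)%mu).
Notation leb R := (@completed_lebesgue_measure R).

(* An element of L^0(I) is represented by any function R -> R whose restriction
   to I is Lebesgue measurable; the values outside I are irrelevant, and all
   notions below are insensitive to changes on a null subset of I. *)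
Definition L0 (R : realType) (I : set R) : set (R -> R) :=
  [set f | measurable_fun (I : set (lebR R)) (f : lebR R -> R)].

(* A set of functions together with a norm; the values of [fnorm] are only
   meaningful on [fcarrier]. *)
Record fspace (R : realType) := FSpace {
  fcarrier :> (R -> R) -> Prop;
  fnorm : (R -> R) -> R }.

(* Compatibility of membership and of the norm with a.e. equality on I is a
   consequence of [bfs_ideal]. *)
Record banach_function_space (R : realType) (I : set R) (X : fspace R) : Prop := {
  bfs_L0 : forall f, X f -> L0 I f;
  bfs_mem0 : X (fun=> 0);
  bfs_memD : forall f g, X f -> X g -> X (f \+ g);
  bfs_memZ : forall a f, X f -> X (a \*o f);
  bfs_norm_ge0 : forall f, X f -> 0 <= fnorm X f;
  bfs_norm_eq0 : forall f, X f -> fnorm X f = 0 ->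
    \forall x \ae leb R, I x -> f x = 0;
  bfs_normZ : forall a f, X f -> fnorm X (a \*o f) = `|a| * fnorm X f;
  bfs_normD : forall f g, X f -> X g ->
    fnorm X (f \+ g) <= fnorm X f + fnorm X g;
  bfs_complete : forall u : nat -> R -> R, (forall n, X (u n)) ->
    (forall e : R, 0 < e -> exists N : nat, forall m n : nat,
       (N <= m)%N -> (N <= n)%N -> fnorm X (u m \- u n) < e) ->
    exists2 f, X f & fnorm X (u n \- f) @[n --> \oo] --> (0 : R);
  bfs_ideal : forall f g, L0 I f -> X g ->
    (\forall x \ae leb R, I x -> `|f x| <= `|g x|) ->
    X f /\ fnorm X f <= fnorm X g;
  bfs_weak_unit : exists2 g, X g & \forall x \ae leb R, I x -> 0 < g x }.

(* The Hardy operators take values in the extended reals: for f >= 0 the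
   integrals may be +oo. *)
Definition hardy (R : realType) (w f : R -> R) (x : R) : \bar R :=
  ((w x)%:E * \int[leb R]_(t in `[0%R, x]) (f t)%:E)%E.

Definition hardy_dual (R : realType) (I : set R) (w f : R -> R) (x : R) : \bar R :=
  (\int[leb R]_(t in I `&` `[x, +oo[) (w t * f t)%:E)%E.

(* T|f| belongs to X, as an element of L^0(I), only if it is finite a.e. *)
Definition derived_space (R : realType) (I : set R)
    (T : (R -> R) -> R -> \bar R) (X : fspace R) : fspace R :=
  let Tabs f := T (fun t => `|f t|) in
  {| fcarrier := fun f => [/\ L0 I f,
       (\forall x \ae leb R, I x -> Tabs f x \is a fin_num)
       & X (fine \o Tabs f)];
     fnorm := fun f => fnorm X (fine \o Tabs f) |}.

Definition nontrivial (R : realType) (I : set R) (E : fspace R) : Prop :=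
  exists2 f, E f & ~ (\forall x \ae leb R, I x -> f x = 0).

(* [s] is the sum in E, i.e. the limit in norm, of the series of the [u n]. *)
Definition norm_sum (R : realType) (E : fspace R) (u : nat -> R -> R)
    (s : R -> R) : Prop :=
  E s /\ fnorm E (fun x => \sum_(k < n) u k x - s x) @[n --> \oo] --> (0 : R).

Definition order_asymptotically_isometric_copy_l1 (R : realType) (I : set R)
    (E : fspace R) : Prop :=
  exists (f : nat -> R -> R) (eps : nat -> R),
    [/\ forall n, E (f n),
        forall m n, m <> n ->
          (leb R).-negligible (I `&` [set x | f m x != 0] `&` [set x | f n x != 0]),
        forall n, 0 < eps n < 1,
        eps @ \oo --> (0 : R)
      & forall a : nat -> R, cvgn (series (fun n => `|a n|)) ->
          exists2 s, norm_sum E (fun n x => a n * f n x) s &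
            limn (series (fun n => (1 - eps n) * `|a n|)) <= fnorm E s
              <= limn (series (fun n => `|a n|))].

(* Main.v *)
Require Import Defs.
From HB Require Import structures.
From mathcomp Require Import all_boot all_order all_algebra.
From mathcomp Require Import all_classical all_reals all_analysis.
From mathcomp Require Import measurable_realfun.
From mathcomp Require Import ring lra.
Import Order.TTheory GRing.Theory Num.Theory.
Import numFieldNormedType.Exports.

Set Implicit Arguments.
Unset Strict Implicit.
Unset Printing Implicit Defensive.

Local Open Scope classical_set_scope.
Local Open Scope ring_scope.

(** Both operators have the form T f (x) = p(x) * \int_(ray x) q f, where ray x
    is the part of I on one fixed side of x: p = w, q = 1 and the left side for
    the Hardy operator, p = 1, q = w and the right side for its dual.

    The copy of l^1 comes from disjointly supported functions whose images under
    T are almost the same element phi of X. Inside an interval ]a, b] there are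
    disjoint sets, the n-th of which meets each of many equal tiles of ]a, b] in
    positive measure. A density g_n that lives on the n-th set and gives every
    tile its full length is so evenly spread that \int_(ray x) g_n differs from
    the length of ray x `&` ]a, b] by at most the tile length h_n, whatever x is
    ([spread_densities]). With f_n = g_n / q and
    phi(x) = p(x) * |ray x `&` ]a, b]| this reads |T f_n - phi| <= h_n e, where
    e = p on the set of points whose ray can reach ]a, b], and e = 0 elsewhere.
    A nonzero f in TX provides an ]a, b] for which e, hence phi, belongs to X:
    for a suitable ]a, b] the integrals \int_(ray x) q |f| are bounded away from
    0 on that set, so that e is dominated by a multiple of T|f|
    ([positive_mass_tile], [weight_on_shadow_mem]).

    Disjointness gives |\sum a_n f_n| = \sum |a_n| f_n, and monotone convergence
    turns this into T|\sum a_n f_n| = \sum |a_n| T f_n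
    ([operator_disjoint_series]), a function that differs from (\sum |a_n|) phi
    by at most (\sum |a_n| h_n) e. The ideal property and the triangle
    inequality place its norm between \sum |a_n| (M - K h_n) and
    \sum |a_n| (M + K h_n), where M and K are the norms of phi and e
    ([l1_combination]). As h_n tends to 0, dividing f_n by slightly more than
    M + K h_n gives the order asymptotically isometric copy
    ([asymptotic_copy_of_l1]). *)

(** * Lebesgue measurable sets and functions *)

Lemma leb_measurable_borel (R : realType) (A : set R) :
  measurable (A : set (measurableTypeR R)) -> measurable (A : set (lebR R)).
Proof. by move=> mA; apply: sub_caratheodory. Qed.

Lemma leb_measurable_itv (R : realType) (i : interval R) :
  measurable ([set` i] : set (lebR R)).
Proof. by apply: leb_measurable_borel; exact: measurable_itv. Qed.

Lemma leb_itvoc (R : realType) (u v : R) : u <= v ->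
  leb R (`]u, v]%classic : set (lebR R)) = (v - u)%:E.
Proof.
move=> uv; rewrite (_ : leb R _ = lebesgue_measure `]u, v]%classic)//.
rewrite lebesgue_measure_itv/= lte_fin.
by case: ltP => // vu; congr (_%:E); lra.
Qed.

Lemma L0_borel (R : realType) (I : set R) (f : R -> R) :
  measurable (I : set (lebR R)) ->
  measurable_fun [set: measurableTypeR R] (f : measurableTypeR R -> R) -> L0 I f.
Proof.
move=> mI mf _ Y mY; apply: measurableI => //.
apply: leb_measurable_borel; rewrite -[X in measurable X]setTI; exact: mf.
Qed.

Lemma L0M (R : realType) (I : set R) (f g : R -> R) :
  L0 I f -> L0 I g -> L0 I (fun x => f x * g x).
Proof. by move=> mf mg; exact: (@measurable_funM _ (lebR R)). Qed.

Lemma L0Z (R : realType) (I : set R) (c : R) (f : R -> R) :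
  L0 I f -> L0 I (fun x => c * f x).
Proof. by move=> mf; apply: L0M => //; exact: (@measurable_cst _ _ (lebR R)). Qed.

Lemma L0_sum (R : realType) (I : set R) (K : nat) (f : nat -> R -> R) :
  (forall k, L0 I (f k)) -> L0 I (fun x => \sum_(k < K) f k x).
Proof.
move=> mf; apply: (@measurable_sum _ (lebR R) R I _ (index_enum _) (fun k : 'I_K => f k)).
by move=> k; exact: mf.
Qed.

Lemma L0_cvg (R : realType) (I : set R) (f : nat -> R -> R) (g : R -> R) :
  (forall n, L0 I (f n)) -> (forall x, I x -> f n x @[n --> \oo] --> g x) ->
  L0 I g.
Proof. by move=> mf fg; exact: (@measurable_fun_cvg _ (lebR R) R I f g). Qed.

(** * Disjoint sets and evenly spread densities *)

(** Shrink each interval to a left piece J i whose length l i decreases so fast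
    that all later pieces together cover at most half of J i, then remove the
    later pieces from J i. *)
Lemma disjoint_subsets_of_intervals (R : realType) (u v : nat -> R) :
  (forall i, u i < v i) ->
  exists D : nat -> set R,
    [/\ forall i, measurable (D i : set (lebR R)),
        forall i, D i `<=` `]u i, v i],
        forall i, (0 < leb R (D i : set (lebR R)))%E
      & forall i j, i <> j -> D i `&` D j = set0].
Proof.
move=> uv.
pose m i := Num.min 1 (v i - u i).
have m_gt0 i : 0 < m i by rewrite lt_min ltr01 subr_gt0 uv.
pose l i := m i / 4 * \prod_(j < i) (m j / 4).
have m4 i : 0 < m i / 4 by rewrite divr_gt0.
have P0 i : 0 < \prod_(j < i) (m j / 4) by apply: prodr_gt0.
have l_gt0 i : 0 < l i by apply: mulr_gt0.
have m41 i : m i / 4 <= 1 / 4 by rewrite ler_pM2r ?invr_gt0// ge_min lexx.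
have P1 i : \prod_(j < i) (m j / 4) <= 1.
  by apply: prodr_ile1 => j _; rewrite ltW//= (le_trans (m41 _))//; lra.
have lm i : l i <= v i - u i.
  apply: (@le_trans _ _ (m i * 1)); last by rewrite mulr1 ge_min lexx orbT.
  rewrite /l -mulrA; apply: ler_pM => //; [exact: ltW|by rewrite mulr_ge0// ltW|].
  by rewrite -[leRHS]mulr1; apply: ler_pM => //; [exact: ltW|lra].
have lS i : l i.+1 <= l i / 4.
  rewrite {1}/l big_ord_recr/= -(mulrC (m i / 4)) -/(l i) mulrC.
  by rewrite ler_pM2l//; have := m41 i.+1; lra.
(* the ratio 1 / 4 beats the weights 2 ^- k.+1 of the geometric series *)
have lD i k : l (i + k.+1)%N <= l i / 2 / (2 ^ k.+1)%:R.
  elim: k => [|k IH].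
    by rewrite addn1 expn1 (le_trans (lS _))//; have := l_gt0 i; lra.
  rewrite addnS (le_trans (lS _))// expnS natrM invfM.
  have := l_gt0 (i + k.+1)%N; move: IH; set y := _ / _ => IH pos.
  by rewrite [X in _ <= _ * X]mulrC mulrA -/y; lra.
pose J i : set (lebR R) := `]u i, u i + l i]%classic.
have mJ i : measurable (J i) by exact: leb_measurable_itv.
have muJ i : leb R (J i) = (l i)%:E.
  by rewrite leb_itvoc ?lerDl ?ltW//; congr (_%:E); ring.
pose L i : set (lebR R) := \bigcup_k J (i + k.+1)%N.
have mL i : measurable (L i) by exact: bigcupT_measurable.
have muL i : (leb R (L i) <= (l i / 2)%:E)%E.
  apply: (@le_trans _ _ (\sum_(k <oo) leb R (J (i + k.+1)%N))%E).
    exact: outer_measure_sigma_subadditive.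
  apply: le_trans (@epsilon_trick0 R (l i / 2) xpredT _); last first.
    by rewrite divr_ge0// ltW.
  by apply: lee_nneseries => // k _; rewrite muJ lee_fin lD.
exists (fun i => J i `\` L i); split.
- by move=> i; exact: measurableD.
- move=> i x [/= /itvP xJ _] /=; rewrite in_itv/= xJ/=.
  have xl : x <= u i + l i by rewrite xJ.
  by have := lm i; lra.
- move=> i; rewrite ltNge; apply/negP => mu0.
  have : (leb R (J i) <= leb R (J i `\` L i) + leb R (L i))%E.
    apply: le_trans (measureU2 _ _ _) => //; last exact: measurableD.
    apply: le_measure; rewrite ?inE//.
    - by apply: measurableU => //; exact: measurableD.
    - by move=> x Jx; have [Lx|nLx] := pselect (L i x); [right|left].
  rewrite muJ => /le_trans/(_ (leeD mu0 (muL i))); rewrite add0e lee_fin.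
  by have := l_gt0 i; lra.
- have key i j : (i < j)%N -> (J i `\` L i) `&` (J j `\` L j) = set0.
    move=> ij; rewrite -subset0 => x [[_ nL] [Jj _]]; apply: nL.
    by exists (j - i.+1)%N => //; rewrite -addSnnS subnKC.
  move=> i j /eqP; rewrite neq_ltn => /orP[/key//|/key].
  by rewrite setIC.
Qed.

Definition ray (R : realType) (I : set R) (d : bool) (x : R) : set R :=
  I `&` (if d then `]-oo, x]%classic else `[x, +oo[%classic).

Lemma ray_measurable (R : realType) (I : set R) (d : bool) (x : R) :
  measurable (I : set (lebR R)) -> measurable (ray I d x : set (lebR R)).
Proof.
by move=> mI; apply: measurableI => //; case: d; exact: leb_measurable_itv.
Qed.

Lemma ray_sub (R : realType) (I : set R) (d : bool) (x : R) : ray I d x `<=` I.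
Proof. exact: subIsetl. Qed.

Lemma le_ray (R : realType) (I : set R) (d : bool) (x y : R) : x <= y ->
  if d then ray I d x `<=` ray I d y else ray I d y `<=` ray I d x.
Proof.
move=> xy; case: d => t [It]; rewrite /= !in_itv/= ?andbT => h; split => //=.
  by rewrite in_itv/= (le_trans h).
by rewrite in_itv/= andbT (le_trans xy).
Qed.

(** A point outside a tile sees it entirely or not at all; this is why only the
    tile containing x can contribute to an error at x. *)
Lemma ray_tile (R : realType) (I : set R) (d : bool) (u v x : R) :
  `]u, v] `<=` I -> ~ `]u, v]%classic x ->
  `]u, v] `<=` ray I d x \/ ray I d x `&` `]u, v] = set0.
Proof.
move=> uvI /negP; rewrite in_itv/= negb_and -leNgt -ltNge => /orP xuv.
have sub (P : set R) : (forall t, u < t -> t <= v -> P t) -> `]u, v] `<=` P.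
  by move=> h t; rewrite /= in_itv/= => /andP[]; exact: h.
have dis (P : set R) : (forall t, u < t -> t <= v -> ~ P t) ->
    P `&` `]u, v] = set0.
  move=> h; rewrite -subset0 => t [Pt]; rewrite /= in_itv/= => /andP[ut tv].
  exact: h Pt.
case: d xuv => -[xu|vx].
- right; apply: dis => t ut tv [_]; rewrite /= in_itv/=; lra.
- left; apply: sub => t ut tv; split; last by rewrite /= in_itv/=; lra.
  by apply: uvI; rewrite /= in_itv/= ut.
- left; apply: sub => t ut tv; split; last by rewrite /= in_itv/= andbT; lra.
  by apply: uvI; rewrite /= in_itv/= ut.
- right; apply: dis => t ut tv [_]; rewrite /= in_itv/= andbT; lra.
Qed.

Notation vol A := (fine (leb _ (A : set (lebR _)))).

Lemma leb_sub_fin (R : realType) (A B : set (lebR R)) :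
  measurable A -> measurable B -> (leb R B < +oo)%E -> A `<=` B ->
  leb R A \is a fin_num.
Proof.
move=> mA mB Boo AB; rewrite ge0_fin_numE//; apply: le_lt_trans Boo.
by apply: le_measure; rewrite ?inE.
Qed.

Lemma leb_itvoc_lty (R : realType) (u v : R) :
  (leb R (`]u, v]%classic : set (lebR R)) < +oo)%E.
Proof.
have [uv|vu] := leP u v; first by rewrite leb_itvoc// ltry.
by rewrite set_itv_ge ?measure0// bnd_simp -leNgt ltW.
Qed.

Lemma vol_le (R : realType) (A B : set (lebR R)) :
  measurable A -> measurable B -> (leb R B < +oo)%E -> A `<=` B ->
  vol A <= vol B.
Proof.
move=> mA mB Boo AB; apply: fine_le.
- exact: leb_sub_fin Boo _.
- exact: leb_sub_fin Boo _.
- by apply: le_measure; rewrite ?inE.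
Qed.

(** Rays are monotone in their end point, so the volume is a monotone function,
    hence a Borel one. *)
Lemma vol_ray_L0 (R : realType) (I : set R) (d : bool) (B : set (lebR R)) :
  measurable (I : set (lebR R)) -> measurable B -> (leb R B < +oo)%E ->
  L0 I (fun x => vol (ray I d x `&` B)).
Proof.
move=> mI mB Boo; apply: L0_borel => //.
have mr x : measurable (ray I d x `&` B : set (lebR R)).
  by apply: measurableI => //; exact: ray_measurable.
have fr x : (leb R (ray I d x `&` B : set (lebR R)) < +oo)%E.
  by apply: le_lt_trans Boo; apply: le_measure; rewrite ?inE//; exact: subIsetr.
case: d mr fr => mr fr.
- apply: nondecreasing_measurable => // x y xy.
  by apply: vol_le => //; apply: setSI; exact: (le_ray I true).
- apply: nonincreasing_measurable => // x y xy.
  by apply: vol_le => //; apply: setSI; exact: (le_ray I false).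
Qed.

Lemma sum_indic_tiles (R : realType) (p : nat -> R) (K : nat) (x : R) :
  (forall k, p k <= p k.+1) ->
  \sum_(k < K) \1_(`]p k, p k.+1]%classic) x = \1_(`]p 0%N, p K]%classic) x :> R.
Proof.
move=> pS; have p0 k : p 0%N <= p k.
  by elim: k => // k IHk; exact: le_trans IHk (pS k).
have E (u v : R) : \1_(`]u, v]%classic) x = (u < x <= v)%R%:R :> R.
  by rewrite indicE mem_setE in_itv.
elim: K => [|K IH].
  by rewrite big_ord0 E; case: ltP => //= ->; rewrite andbF.
rewrite big_ord_recr/= IH !E.
have := p0 K; have := pS K.
case: (ltP (p 0%N) x); case: (leP x (p K)); case: (ltP (p K) x);
  case: (leP x (p K.+1)) => //= *; rewrite ?addr0 ?add0r//; lra.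
Qed.

Lemma sum_vol_tiles (R : realType) (p : nat -> R) (K : nat) (A : set (lebR R)) :
  measurable A -> (forall k, p k <= p k.+1) ->
  \sum_(k < K) vol (A `&` `]p k, p k.+1]) = vol (A `&` `]p 0%N, p K]).
Proof.
move=> mA pS; have p0 k : p 0%N <= p k.
  by elim: k => // k IHk; exact: le_trans IHk (pS k).
have mI u v : measurable (A `&` `]u, v] : set (lebR R)).
  by apply: measurableI => //; exact: leb_measurable_itv.
have fI u v : leb R (A `&` `]u, v] : set (lebR R)) \is a fin_num.
  apply: leb_sub_fin (leb_itvoc_lty u v) _ => //; exact: leb_measurable_itv.
elim: K => [|K IH].
  by rewrite big_ord0 set_itvoc0 setI0 measure0.
have cup : `]p 0%N, p K.+1]%classic = `]p 0%N, p K] `|` `]p K, p K.+1].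
  have := p0 K; have := pS K => pK pK0.
  apply/seteqP; split => [t|t [|]]; rewrite /= !in_itv/=; [|lra|lra].
  by move=> ?; case: (leP t (p K)); [left|right]; lra.
rewrite big_ord_recr/= IH -fineD// cup setIUr measureU//.
by rewrite -subset0 => t [[_ +] [_]]; rewrite /= !in_itv/=; lra.
Qed.

(** The density on B has the same total mass as the tile, so a ray that contains
    or misses the whole tile makes no error; the other rays are those that end
    inside it, and there both masses lie between 0 and v - u. *)
Lemma tile_mass_error (R : realType) (I : set R) (d : bool) (u v x : R)
    (B : set (lebR R)) :
  measurable (I : set (lebR R)) -> u < v -> `]u, v] `<=` I ->
  measurable B -> B `<=` `]u, v] -> (0 < leb R B)%E ->
  `|(v - u) / vol B * vol (B `&` ray I d x) - vol (ray I d x `&` `]u, v])|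
    <= (v - u) * \1_(`]u, v]%classic) x.
Proof.
move=> mI uv uvI mB Buv B0.
have mC : measurable (`]u, v]%classic : set (lebR R)) by exact: leb_measurable_itv.
have Coo : (leb R (`]u, v]%classic : set (lebR R)) < +oo)%E.
  exact: leb_itvoc_lty.
have mr : measurable (ray I d x : set (lebR R)) by exact: ray_measurable.
have Boo : (leb R B < +oo)%E.
  by apply: le_lt_trans Coo; apply: le_measure; rewrite ?inE.
have volB : 0 < vol B by rewrite fine_gt0// B0.
have volC : vol `]u, v] = v - u by rewrite leb_itvoc// ltW.
have vu : 0 < v - u by rewrite subr_gt0.
have [xC|xC] := pselect (`]u, v]%classic x).
- rewrite indicE mem_set// mulr1 ler_distl.
  have m0 : 0 <= (v - u) / vol B * vol (B `&` ray I d x).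
    by rewrite mulr_ge0 ?fine_ge0// divr_ge0// ltW.
  have m1 : (v - u) / vol B * vol (B `&` ray I d x) <= v - u.
    rewrite mulrAC ler_pdivrMr// ler_pM2l//.
    by apply: vol_le => //; exact: measurableI.
  have c0 : 0 <= vol (ray I d x `&` `]u, v]) by rewrite fine_ge0.
  have c1 : vol (ray I d x `&` `]u, v]) <= v - u.
    by rewrite -volC; apply: vol_le => //; exact: measurableI.
  by apply/andP; split; lra.
- rewrite indicE memNset// mulr0.
  have [sub|dis] := ray_tile d uvI xC.
  + rewrite (setIidl (subset_trans Buv sub)) (setIidr sub) volC divfK ?gt_eqF//.
    by rewrite subrr normr0.
  + rewrite dis (_ : B `&` _ = set0) ?measure0/= ?mulr0 ?subrr ?normr0//.
    by rewrite -subset0 -dis setIC; exact: setIS.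
Qed.

(** The n-th density uses N + n + 1 equal tiles. Applying
    [disjoint_subsets_of_intervals] to the tiles of all subdivisions at once,
    enumerated by [pickle], makes the supports disjoint across different n. The
    errors of the individual tiles do not accumulate, since x lies in at most one
    of them. *)
Lemma spread_densities (R : realType) (I : set R) (d : bool) (a b : R) (N : nat) :
  measurable (I : set (lebR R)) -> a < b -> `]a, b] `<=` I ->
  exists g : nat -> R -> R, exists J : nat -> R -> R,
  [/\ forall n, measurable_fun [set: lebR R] (g n : lebR R -> R),
      forall n x, 0 <= g n x,
      forall n x, g n x != 0 -> `]a, b]%classic x,
      forall m n x, m <> n -> g m x != 0 -> g n x = 0
    & forall n, [/\ L0 I (J n),
        forall x, (\int[leb R]_(t in ray I d x) (g n t)%:E = (J n x)%:E)%E
      & forall x, `|J n x - vol (ray I d x `&` `]a, b])|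
          <= (b - a) / (N + n).+1%:R * \1_(`]a, b]%classic) x]].
Proof.
move=> mI ab abI.
pose h n : R := (b - a) / (N + n).+1%:R.
have h_gt0 n : 0 < h n by rewrite divr_gt0 ?subr_gt0.
pose p n k : R := a + k%:R * h n.
have pS n k : p n k < p n k.+1.
  by rewrite ltrD2l ltr_pM2r// ltr_nat.
have p0 n : p n 0%N = a by rewrite /p mul0r addr0.
have pN n : p n (N + n).+1 = b.
  by rewrite /p /h mulrC divfK ?pnatr_eq0//; ring.
have hE n k : p n k.+1 - p n k = h n by rewrite /p -natr1; ring.
have pmono n : {homo p n : i j / (i <= j)%N >-> i <= j}.
  by move=> i j ij; rewrite lerD2l ler_wpM2r ?ler_nat// ltW.
pose dec i : nat * nat := odflt (0, 0)%N (unpickle i).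
have [D [mD subD D0 disD]] := @disjoint_subsets_of_intervals R
  (fun i => p (dec i).1 (dec i).2) (fun i => p (dec i).1 (dec i).2.+1)
  (fun i => pS _ _).
pose B (n k : nat) : set (lebR R) := D (pickle (n, k)).
have mB n k : measurable (B n k) by exact: mD.
have subB n k : B n k `<=` `]p n k, p n k.+1].
  by have := subD (pickle (n, k)); rewrite /dec pickleK.
have B0 n k : (0 < leb R (B n k))%E by exact: D0.
have disB n k n' k' x : B n k x -> B n' k' x -> (n, k) = (n', k').
  move=> Bx Bx'; apply: contrapT => ne.
  have : (B n k `&` B n' k') x by [].
  rewrite disD// => pe; apply: ne.
  exact: (pcan_inj pickleK) pe.
have tileab n (k : 'I_(N + n).+1) : `]p n k, p n k.+1] `<=` `]a, b].
  move=> x; rewrite /= !in_itv/= -(p0 n) -(pN n) => /andP[kx xk].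
  by rewrite (le_lt_trans _ kx) ?pmono//= (le_trans xk)// pmono.
pose c n k := h n / vol (B n k).
have c_ge0 n k : 0 <= c n k by rewrite divr_ge0 ?fine_ge0// ltW.
pose g n x : R := \sum_(k < (N + n).+1) c n k * \1_(B n k) x.
pose J n x : R := \sum_(k < (N + n).+1) c n k * vol (B n k `&` ray I d x).
have gB n x : g n x != 0 -> exists k : 'I_(N + n).+1, B n k x.
  move=> gx; apply: contrapT => nB; move: gx; rewrite /g big1 ?eqxx// => k _.
  by rewrite indicE memNset ?mulr0// => Bx; apply: nB; exists k.
have mr x : measurable (ray I d x : set (lebR R)) by exact: ray_measurable.
have Boo n k : (leb R (B n k) < +oo)%E.
  apply: le_lt_trans (leb_itvoc_lty (p n k) (p n k.+1)).
  by apply: le_measure; rewrite ?inE//; exact: leb_measurable_itv.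
exists g, J; split.
- move=> n; apply: measurable_sum => k; apply: measurable_funM => //.
- by move=> n x; apply: sumr_ge0 => k _; rewrite mulr_ge0.
- by move=> n x /gB[k Bx]; apply: (tileab n k); exact: subB.
- move=> m n x mn /gB[k Bx]; apply: contrapT => /eqP /gB[k' Bx'].
  by apply: mn; have [] := disB _ _ _ _ _ Bx Bx'.
- move=> n; split.
  + apply: (@L0_sum R I _ (fun k x => c n k * vol (B n k `&` ray I d x))) => k; apply: L0Z.
    rewrite (_ : (fun x => _) = (fun x => vol (ray I d x `&` B n k))).
      exact: vol_ray_L0.
    by apply/funext => x; rewrite setIC.
  + move=> x.
    have mE k : measurable_fun (ray I d x : set (lebR R))
        (EFin \o (\1_(B n k) : lebR R -> R)).
      by apply/measurable_EFinP; exact: (@measurable_indic _ (lebR R)).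
    have mcE (k : 'I_(N + n).+1) : measurable_fun (ray I d x : set (lebR R))
        (fun t : lebR R => ((c n k)%:E * (\1_(B n k) t)%:E)%E).
      exact: (measurable_funeM (c n k)%:E (mE k)).
    rewrite (_ : (fun t => (g n t)%:E) = (fun t : lebR R =>
        \sum_(k < (N + n).+1) (c n k)%:E * (\1_(B n k) t)%:E)%E); last first.
      by apply/funext => t; rewrite /g -sumEFin.
    rewrite (ge0_integral_sum (leb R) (mr x) mcE); last first.
      by move=> k t _; rewrite -EFinM lee_fin mulr_ge0.
    rewrite /J -sumEFin; apply: eq_bigr => k _.
    have E0 t : ray I d x t -> (0 <= (EFin \o (\1_(B n k) : lebR R -> R)) t)%E.
      by move=> _; rewrite lee_fin.
    have := ge0_integralZl_EFin (leb R) (mr x) E0 (mE k) (c_ge0 n k).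
    move=> /= ->.
    rewrite (integral_indic (leb R) (mr x) (mB n k)) [RHS]EFinM fineK//.
    by apply: leb_sub_fin (Boo n k) _ => //; exact: measurableI.
  + move=> x.
    have := @sum_vol_tiles R (p n) (N + n).+1 (ray I d x) (mr x)
      (fun k => ltW (pS n k)).
    rewrite p0 pN => <-; rewrite /J -sumrB.
    have := @sum_indic_tiles R (p n) (N + n).+1 x (fun k => ltW (pS n k)).
    rewrite p0 pN => <-; rewrite mulr_sumr -/(h n).
    apply: le_trans (ler_norm_sum _ _ _) _; apply: ler_sum => k _.
    rewrite /c -(hE n k); apply: tile_mass_error => //.
    exact: subset_trans (tileab n k) abI.
Qed.

(** * Sequences in a Banach function space with almost equal images *)

Lemma cvg_series_lin (R : realType) (u v : nat -> R) (x y : R) :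
  cvgn (series u) -> cvgn (series v) ->
  series (fun n => x * u n + y * v n) @ \oo -->
    x * limn (series u) + y * limn (series v).
Proof.
move=> cu cv.
rewrite (_ : series _ = fun n => x * series u n + y * series v n); last first.
  by apply/funext => n; rewrite /series/= big_split/= -!mulr_sumr.
by apply: cvgD; apply: cvgMl_tmp.
Qed.

Lemma cvg_series_tail (R : realType) (u : nat -> R) (n : nat) :
  cvgn (series u) ->
  series (fun k => if (k < n)%N then 0 else u k) @ \oo -->
    limn (series u) - series u n.
Proof.
move=> cu.
have E : \forall m \near \oo, series u m - series u n =
    series (fun k => if (k < n)%N then 0 else u k) m.
  exists n => // m /= nm; rewrite /series/= (big_cat_nat (leq0n n) nm)/=.
  rewrite [in RHS](big_cat_nat (leq0n n) nm)/=.
  rewrite [X in _ = X + _](_ : _ = 0); last first.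
    by rewrite big_nat big1// => k /andP[_ ->].
  rewrite add0r addrAC subrr add0r big_nat [RHS]big_nat.
  by apply: eq_bigr => k /andP[nk _]; rewrite ltnNge nk.
apply: cvg_trans; first exact: near_eq_cvg E.
by apply: cvgB => //; exact: cvg_cst.
Qed.

Lemma cvg_series_single (R : realType) (u : nat -> R) (n : nat) :
  (forall k, k <> n -> u k = 0) -> series u @ \oo --> u n.
Proof.
move=> u0; apply: cvg_near_cst; exists n.+1 => // m /= nm.
rewrite /series/= (bigD1_seq n) ?mem_index_iota ?iota_uniq//=.
by rewrite big1 ?addr0// => k /eqP/u0.
Qed.

Lemma cvg_series_normM (R : realType) (a c : nat -> R) (C : R) :
  (forall n, 0 <= c n <= C) -> cvgn (series (fun n => `|a n|)) ->
  cvgn (series (fun n => `|a n| * c n)).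
Proof.
move=> c0C ca; have C0 : 0 <= C by have /andP[] := c0C 0%N; exact: le_trans.
apply: (@series_le_cvg _ _ (fun n => C * `|a n|)).
- by move=> n; have /andP[c0 _] := c0C n; rewrite mulr_ge0.
- by move=> n; rewrite mulr_ge0.
- by move=> n; have /andP[_ cC] := c0C n; rewrite mulrC ler_wpM2r.
- exact: (@is_cvg_seriesZ _ _ C).
Qed.

Lemma bfs_congr (R : realType) (I : set R) (X : fspace R) (f g : R -> R) :
  banach_function_space I X -> X g -> (forall x, I x -> f x = g x) ->
  X f /\ fnorm X f = fnorm X g.
Proof.
move=> hX Xg fg.
have mf : L0 I f.
  apply: (@eq_measurable_fun _ _ (lebR R) _ I g); last exact: (bfs_L0 hX).
  by move=> x /set_mem/fg.
have [Xf fleg] : X f /\ fnorm X f <= fnorm X g.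
  by apply: (bfs_ideal hX) => //; apply: aeW => x /fg ->.
have [_ glef] : X g /\ fnorm X g <= fnorm X f.
  apply: (bfs_ideal hX) => //; first exact: (bfs_L0 hX).
  by apply: aeW => x /fg ->.
by split => //; apply/eqP; rewrite eq_le fleg.
Qed.

(** If all the t n = T|f n| are close to one phi, then the image P of a
    combination s satisfies |P - A phi| <= B e with A = \sum |a_n| and
    B = \sum |a_n| del_n, and both norm estimates are triangle inequalities. *)
Lemma l1_combination (R : realType) (I : set R) (X : fspace R)
    (T : (R -> R) -> R -> \bar R) (f t : nat -> R -> R) (phi e : R -> R)
    (del : nat -> R) (D : R) (a : nat -> R)
    (s := fun x => limn (series (fun n => a n * f n x))) :
  banach_function_space I X -> X phi -> X e ->
  (forall x, I x -> 0 <= phi x) -> (forall x, I x -> 0 <= e x) ->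
  (forall n, 0 <= del n <= D) ->
  (forall n, L0 I (t n)) ->
  (forall n x, I x -> 0 <= t n x) ->
  (forall n x, I x -> `|t n x - phi x| <= del n * e x) ->
  cvgn (series (fun n => `|a n|)) -> L0 I s ->
  (forall x, I x -> cvgn (series (fun n => `|a n| * t n x)) ->
    T (fun y => `|s y|) x = (limn (series (fun n => `|a n| * t n x)))%:E) ->
  derived_space I T X s /\
  limn (series (fun n => `|a n| * (fnorm X phi - fnorm X e * del n)))
    <= fnorm (derived_space I T X) s
    <= limn (series (fun n => `|a n| * (fnorm X phi + fnorm X e * del n))).
Proof.
move=> hX Xphi Xe phi0 e0 delD mt t0 tphi ca ms Ts.
set M := fnorm X phi; set K := fnorm X e.
have cdel := cvg_series_normM delD ca.
pose A := limn (series (fun n => `|a n|)).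
pose B := limn (series (fun n => `|a n| * del n)).
have A0 : 0 <= A.
  by apply: limr_ge => //; apply: nearW => n; exact: sumr_ge0.
have B0 : 0 <= B.
  apply: limr_ge => //; apply: nearW => n; apply: sumr_ge0 => k _.
  by have /andP[d0 _] := delD k; rewrite mulr_ge0.
have linAB x y : series (fun n => `|a n| * (x + y * del n)) @ \oo -->
    x * A + y * B.
  rewrite (_ : (fun n => `|a n| * (x + y * del n)) =
      (fun n => x * `|a n| + y * (`|a n| * del n))).
    exact: cvg_series_lin.
  by apply/funext => n; ring.
have t_le n x : I x ->
    phi x - e x * del n <= t n x /\ t n x <= phi x + e x * del n.
  by move=> /(tphi n); rewrite ler_distl [del n * _]mulrC => /andP[].
pose P x := limn (series (fun n => `|a n| * t n x)).
have cP x : I x -> cvgn (series (fun n => `|a n| * t n x)).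
  move=> Ix; apply: (@cvg_series_normM _ _ _ (phi x + e x * D)) => // n.
  rewrite t0//=; have [_ /le_trans] := t_le n x Ix; apply.
  by rewrite lerD2l ler_wpM2l ?e0//; have /andP[] := delD n.
have P0 x : I x -> 0 <= P x.
  move=> Ix; apply: limr_ge; first exact: cP.
  by apply: nearW => n; apply: sumr_ge0 => k _; rewrite mulr_ge0// t0.
have P_le x : I x -> P x <= A * phi x + B * e x.
  move=> Ix; rewrite mulrC [B * _]mulrC -(cvg_lim _ (linAB _ _))//.
  apply: lim_series_le; [exact: cP|exact: cvgP (linAB _ _)|] => n.
  by rewrite ler_wpM2l//; have [] := t_le n x Ix.
have P_ge x : I x -> A * phi x <= P x + B * e x.
  move=> Ix; suff : phi x * A + - e x * B <= P x by lra.
  rewrite -(cvg_lim _ (linAB _ _))//.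
  apply: lim_series_le; [exact: cvgP (linAB _ _)|exact: cP|] => n.
  by rewrite ler_wpM2l// mulNr; have [] := t_le n x Ix.
have mP : L0 I P.
  apply: (@L0_cvg _ _ (fun n x => \sum_(k < n) `|a k| * t k x)).
    by move=> n; apply: (@L0_sum R I n (fun k x => `|a k| * t k x)) => k; exact: L0Z.
  by move=> x /cP; rewrite /P /series/=; under eq_fun do rewrite big_mkord.
have XAB : X ((A \*o phi) \+ (B \*o e)).
  by apply: (bfs_memD hX); apply: (bfs_memZ hX).
have [XP normP] : X P /\ fnorm X P <= fnorm X ((A \*o phi) \+ (B \*o e)).
  apply: (bfs_ideal hX) => //; apply: aeW => x Ix /=.
  rewrite !ger0_norm ?P0 ?P_le// addr_ge0// mulr_ge0//; [exact: phi0|exact: e0].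
have XPB : X (P \+ (B \*o e)).
  by apply: (bfs_memD hX) => //; apply: (bfs_memZ hX).
have [_ normA] : X (A \*o phi) /\ fnorm X (A \*o phi) <= fnorm X (P \+ (B \*o e)).
  apply: (bfs_ideal hX) => //; first exact/(bfs_L0 hX)/(bfs_memZ hX).
  apply: aeW => x Ix /=; rewrite !ger0_norm ?P_ge//.
    by rewrite addr_ge0 ?P0// mulr_ge0// e0.
  by rewrite mulr_ge0// phi0.
have TP x : I x -> T (fun y => `|s y|) x = (P x)%:E.
  by move=> Ix; rewrite Ts//; exact: cP.
have [XT normT] : X (fine \o T (fun y => `|s y|)) /\
    fnorm X (fine \o T (fun y => `|s y|)) = fnorm X P.
  by apply: (bfs_congr hX XP) => x Ix /=; rewrite TP.
split; first by split => //; apply: aeW => x Ix; rewrite TP.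
rewrite /derived_space/= normT.
rewrite (_ : (fun n => `|a n| * (M - K * del n)) =
    (fun n => `|a n| * (M + - K * del n))); last first.
  by apply/funext => n; rewrite mulNr.
rewrite (cvg_lim _ (linAB _ _))// (cvg_lim _ (linAB _ _))//.
have nZ c g : 0 <= c -> X g -> fnorm X (c \*o g) = c * fnorm X g.
  by move=> c0 Xg; rewrite (bfs_normZ hX)// ger0_norm.
apply/andP; split.
- have : A * M <= fnorm X P + B * K.
    rewrite -!nZ//; apply: le_trans normA _; apply: (bfs_normD hX) => //.
    exact: (bfs_memZ hX).
  by lra.
- apply: le_trans normP _; rewrite mulrC [K * _]mulrC -!nZ//.
  by apply: (bfs_normD hX); apply: (bfs_memZ hX).
Qed.

Lemma disjoint_pointwise_single (R : realType) (f : nat -> R -> R) (x : R) :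
  (forall m n x, m <> n -> f m x != 0 -> f n x = 0) ->
  exists n, forall k, k <> n -> f k x = 0.
Proof.
move=> disj; have [[n fn]|no] := pselect (exists n, f n x != 0).
  by exists n => k kn; apply: disj fn => nk; exact: kn.
exists 0%N => k _; apply: contrapT => /eqP fk; apply: no; by exists k.
Qed.

Lemma cvg_disjoint_series (R : realType) (f : nat -> R -> R) (a : nat -> R) (x : R) :
  (forall m n x, m <> n -> f m x != 0 -> f n x = 0) ->
  cvgn (series (fun n => a n * f n x)).
Proof.
move=> /(@disjoint_pointwise_single _ _ x)[n fn]; apply: cvgP.
by apply: cvg_series_single => k /fn ->; rewrite mulr0.
Qed.

(** The n-th function is normalised by c n = M + (K + 1) del_n, where M and K are
    the norms of phi and e. The excess of del_n over the upper bound M + K del_n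
    keeps eps n = 1 - (M - K del_n) / c n positive even if K = 0. The upper norm
    estimate, applied to the tails of a combination, also gives the convergence
    of the series in norm. *)
Lemma asymptotic_copy_of_l1 (R : realType) (I : set R) (X : fspace R)
    (T : (R -> R) -> R -> \bar R) (f t : nat -> R -> R) (phi e : R -> R)
    (del : nat -> R) (D : R) :
  banach_function_space I X -> X phi -> X e -> 0 < fnorm X phi ->
  (forall x, I x -> 0 <= phi x) -> (forall x, I x -> 0 <= e x) ->
  (forall n, 0 < del n <= D) -> del @ \oo --> (0 : R) ->
  (forall n, fnorm X e * del n < fnorm X phi) ->
  (forall n, L0 I (t n)) ->
  (forall n x, I x -> 0 <= t n x) ->
  (forall n x, I x -> `|t n x - phi x| <= del n * e x) ->
  (forall n, L0 I (f n)) ->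
  (forall m n x, m <> n -> f m x != 0 -> f n x = 0) ->
  (forall a : nat -> R, forall x, I x ->
    cvgn (series (fun n => `|a n| * t n x)) ->
    T (fun y => `|limn (series (fun n => a n * f n y))|) x
      = (limn (series (fun n => `|a n| * t n x)))%:E) ->
  order_asymptotically_isometric_copy_l1 I (derived_space I T X).
Proof.
move=> hX Xphi Xe M0 phi0 e0 delD del0 KdM mt t0 tphi mf disj Tser.
set M := fnorm X phi in M0 KdM *; set K := fnorm X e in KdM *.
have K0 : 0 <= K by exact: (bfs_norm_ge0 hX).
have del_gt0 n : 0 < del n by have /andP[] := delD n.
have delD' n : 0 <= del n <= D by have /andP[/ltW -> ->] := delD n.
pose s (a : nat -> R) x := limn (series (fun n => a n * f n x)).
have ms a : L0 I (s a).
  apply: (@L0_cvg _ _ (fun n x => \sum_(k < n) a k * f k x)).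
    by move=> n; apply: (@L0_sum R I n (fun k x => a k * f k x)) => k; exact: L0Z.
  move=> x _; have := @cvg_disjoint_series _ _ a x disj.
  by rewrite /s /series/=; under eq_fun do rewrite big_mkord.
have core (a : nat -> R) (ca : cvgn (series (fun n => `|a n|))) :
    derived_space I T X (s a) /\
    limn (series (fun n => `|a n| * (M - K * del n)))
      <= fnorm (derived_space I T X) (s a)
      <= limn (series (fun n => `|a n| * (M + K * del n))) :=
  l1_combination hX Xphi Xe phi0 e0 delD' mt t0 tphi ca (ms a)
    (fun x Ix => Tser a x Ix).
pose c n := M + (K + 1) * del n.
have c_gt0 n : 0 < c n by rewrite addr_gt0// mulr_gt0// ltr_wpDl.
have cM n : M <= c n by rewrite lerDl mulr_ge0 ?addr_ge0// ltW.
have V_le n : 0 <= (c n)^-1 <= M^-1.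
  by rewrite invr_ge0 ltW//= lef_pV2 ?posrE.
pose eps n := 1 - (M - K * del n) / c n.
have epsE n : eps n = (2 * K + 1) * del n / c n.
  by rewrite /eps /c; field; rewrite -/(c n) gt_eqF.
have summable (a : nat -> R) : cvgn (series (fun n => `|a n|)) ->
    cvgn (series (fun n => `|a n / c n|)).
  move=> ca; rewrite (_ : (fun n => _) = (fun n => `|a n| * (c n)^-1)).
    exact: cvg_series_normM V_le ca.
  by apply/funext => n; rewrite normrM [X in _ * X = _]ger0_norm ?invr_ge0// ltW.
have Upper n : 0 <= M + K * del n <= M + K * D.
  have /andP[d0 dD] := delD' n.
  by rewrite lerD2l ler_wpM2l// addr_ge0 ?mulr_ge0// ltW.
have Lower n : 0 <= M - K * del n <= M.
  by rewrite subr_ge0 ltW//= gerBl mulr_ge0// ltW.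
exists (fun n x => (c n)^-1 * f n x), eps; split.
- move=> n.
  have su k : k <> n -> `|if k == n then (c n)^-1 else 0| = 0 :> R.
    by move=> /eqP/negbTE ->; rewrite normr0.
  have [] := core (fun k => if k == n then (c n)^-1 else 0).
    by apply: cvgP; apply: cvg_series_single su.
  rewrite (_ : s _ = (fun x => (c n)^-1 * f n x))//; apply/funext => x.
  apply: cvg_lim => //.
  rewrite (_ : (c n)^-1 * f n x = (if n == n then (c n)^-1 else 0) * f n x).
    apply: (@cvg_series_single _ (fun k => (if k == n then (c n)^-1 else 0) * f k x)).
    by move=> k /eqP/negbTE ->; rewrite mul0r.
  by rewrite eqxx.
- move=> m n mn; rewrite [X in _.-negligible X](_ : _ = set0).
    exact: negligible_set0.
  rewrite -subset0 => x [[_ /= fm] /= /eqP]; apply.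
  rewrite (disj m n) ?mulr0//.
  by move: fm; rewrite mulf_eq0 negb_or => /andP[].
- move=> n; apply/andP; split.
    by rewrite epsE divr_gt0// mulr_gt0//; lra.
  by rewrite /eps ltrBlDr ltrDl divr_gt0// subr_gt0.
- have lim0 : (2 * K + 1) / M * del n @[n --> \oo] --> (0 : R).
    by rewrite -[X in _ --> X](mulr0 ((2 * K + 1) / M)); exact: cvgMl_tmp.
  apply: squeeze_cvgr lim0; last exact: cvg_cst.
  apply: nearW => n; rewrite epsE; apply/andP; split.
    by rewrite divr_ge0 ?mulr_ge0 ?ltW//; lra.
  rewrite mulrAC; apply: ler_wpM2r; first exact: ltW.
  apply: ler_wpM2l; first by lra.
  by have /andP[] := V_le n.
- move=> a ca.
  have cal := summable a ca.
  have [Es /andP[lo up]] := core _ cal.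
  exists (s (fun n => a n / c n)).
    split => //.
    pose w k := `|a k / c k| * (M + K * del k).
    have cw : cvgn (series w) by exact: cvg_series_normM Upper cal.
    have wlim : limn (series w) - series w n @[n --> \oo] --> (0 : R).
      rewrite -[X in _ --> X](subrr (limn (series w))).
      by apply: cvgB => //; exact: cvg_cst.
    apply: squeeze_cvgr wlim; last exact: cvg_cst.
    apply: nearW => n.
    pose be k : R := if (k < n)%N then 0 else - (a k / c k).
    have cbe : cvgn (series (fun k => `|be k|)).
      rewrite (_ : (fun k => _) =
          (fun k => if (k < n)%N then 0 else `|a k / c k|)).
        by apply: cvgP; exact: cvg_series_tail.
      by apply/funext => k; rewrite /be; case: ifP; rewrite ?normr0 ?normrN.
    have [Esb /andP[_ upb]] := core _ cbe.
    (* the error of the n-th partial sum is itself a combination, with the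
       coefficients be, which vanish below n *)
    have -> : (fun x => \sum_(k < n) a k * ((c k)^-1 * f k x)
        - s (fun n => a n / c n) x) = s be.
      apply/funext => x; apply/esym/cvg_lim => //.
      have cf := @cvg_disjoint_series _ _ (fun k => a k / c k) x disj.
      have /cvgN := cvg_series_tail (n := n) cf.
      rewrite opprB; rewrite (_ : series _ n = \sum_(k < n) a k * ((c k)^-1 * f k x)).
        rewrite -seriesN (_ : - _ = (fun k => be k * f k x))//.
        apply/funext => k; rewrite /be fctE; case: ifP => _.
          by rewrite oppr0 mul0r.
        by rewrite mulNr.
      by rewrite /series/= big_mkord; apply: eq_bigr => k _; rewrite mulrA.
    apply/andP; split.
      by apply: (bfs_norm_ge0 hX); case: Esb.
    apply: le_trans upb _.
    rewrite -(cvg_lim _ (cvg_series_tail (n := n) cw))//.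
    rewrite (_ : (fun k => `|be k| * _) = (fun k => if (k < n)%N then 0 else w k))//.
    apply/funext => k; rewrite /be; case: ifP => _; first by rewrite normr0 mul0r.
    by rewrite normrN.
  have nac n : `|a n / c n| = `|a n| / c n.
    by rewrite normrM [X in _ * X = _]ger0_norm ?invr_ge0// ltW.
  apply/andP; split.
    apply: le_trans lo; rewrite le_eqVlt; apply/orP; left; apply/eqP.
    congr (limn (series _)); apply/funext => n.
    by rewrite nac /eps; ring.
  apply: le_trans up _; apply: lim_series_le => //.
    exact: cvg_series_normM Upper cal.
  move=> n; rewrite nac -mulrA ler_piMr// mulrC ler_pdivrMr// mul1r.
  by have := del_gt0 n; rewrite /c; lra.
Qed.

(** * Integral operators over rays *)

(** The points whose ray can reach ]a, b]. *)
Definition shadow (R : realType) (d : bool) (a b : R) : set R :=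
  if d then `]a, +oo[%classic else `]-oo, b]%classic.

Lemma L0V (R : realType) (I : set R) (q : R -> R) :
  L0 I q -> (forall x, I x -> 0 < q x) -> L0 I (fun x => (q x)^-1).
Proof.
move=> mq q0; apply: (@eq_measurable_fun _ _ (lebR R) _ I
  (fun x => expR (- ln (q x)))).
  by move=> x /set_mem Ix; rewrite expRN lnK// posrE q0.
apply: (@measurableT_comp _ _ _ (lebR R) _ _ (fun y : R => expR (- ln y))) => //.
apply: (@measurableT_comp _ _ _ _ _ _ (@expR R)) => //.
exact: measurable_funN (@measurable_ln R).
Qed.

Lemma nneseries_EFin (R : realType) (u : nat -> R) : cvgn (series u) ->
  (\sum_(k <oo) (u k)%:E)%E = (limn (series u))%:E.
Proof.
move=> cu; rewrite -EFin_lim//; congr (limn _); apply/funext => n /=.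
by rewrite sumEFin.
Qed.

Lemma ray_off_shadow (R : realType) (I : set R) (d : bool) (a b x : R) :
  ~ shadow d a b x -> ray I d x `&` `]a, b] = set0.
Proof.
move=> xS; rewrite -subset0 => t [[_ tx] tab]; apply: xS.
by move: tab tx; rewrite /shadow; case: d; rewrite /= !in_itv/= ?andbT; lra.
Qed.

Lemma tile_sub_shadow (R : realType) (d : bool) (a b : R) :
  `]a, b] `<=` shadow d a b.
Proof. by move=> x; rewrite /shadow; case: d; rewrite /= !in_itv/= ?andbT; lra. Qed.

Lemma vol_ray_gt0 (R : realType) (I : set R) (d : bool) (a b x : R) :
  measurable (I : set (lebR R)) -> `]a, b] `<=` I -> a < x < b ->
  0 < vol (ray I d x `&` `]a, b]).
Proof.
move=> mI abI /andP[ax xb].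
pose u := if d then a else x; pose v := if d then x else b.
have uv : u < v by rewrite /u /v; case: (d).
apply: (@lt_le_trans _ _ (vol `]u, v])).
  by rewrite leb_itvoc ?ltW//= subr_gt0.
apply: vol_le.
- exact: leb_measurable_itv.
- by apply: measurableI; [exact: ray_measurable|exact: leb_measurable_itv].
- apply: le_lt_trans (leb_itvoc_lty a b); apply: le_measure; rewrite ?inE.
  + by apply: measurableI; [exact: ray_measurable|exact: leb_measurable_itv].
  + exact: leb_measurable_itv.
  + exact: subIsetr.
- have sub : `]u, v] `<=` `]a, b].
    by move=> t; rewrite /u /v; case: (d); rewrite /= !in_itv/=; lra.
  move=> t tuv; split; last exact: sub.
  split; first exact/abI/sub.
  by move: tuv; rewrite /u /v; case: (d); rewrite /= !in_itv/= ?andbT; lra.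
Qed.

Section kernel_operator.
Context (R : realType) (I : set R) (d : bool) (X : fspace R).
Context (p q : R -> R) (T : (R -> R) -> R -> \bar R).
Hypothesis hX : banach_function_space I X.
Hypothesis mI : measurable (I : set (lebR R)).
Hypotheses (mp : L0 I p) (mq : L0 I q).
Hypothesis p0 : forall x, I x -> 0 < p x.
Hypothesis q0 : forall x, I x -> 0 < q x.
Hypothesis TE : forall (f : R -> R) x, I x -> T (fun t => `|f t|) x =
  ((p x)%:E * \int[leb R]_(t in ray I d x) (q t * `|f t|)%:E)%E.

(** On the shadow T|f| is at least c times p. *)
Lemma weight_on_shadow_mem (f : R -> R) (a b c : R) :
  derived_space I T X f -> 0 < c ->
  (forall x, I x -> shadow d a b x ->
    (c%:E <= \int[leb R]_(t in ray I d x) (q t * `|f t|)%:E)%E) ->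
  X (fun x => p x * \1_(shadow d a b) x).
Proof.
move=> [_ finT XT] c0 cle.
have [] // := bfs_ideal hX (f := fun x => p x * \1_(shadow d a b) x)
  (g := c^-1 \*o (fine \o T (fun t => `|f t|))).
- apply: L0M => //; apply: L0_borel => //; apply: measurable_indic.
  by rewrite /shadow; case: (d); exact: measurable_itv.
- exact: (bfs_memZ hX).
- apply: (@filterS _ _ (ae_filter_ringOfSetsType (leb R))) finT.
  move=> x Tfin Ix; have := Tfin Ix => /= {}Tfin.
  rewrite normrM (gtr0_norm (p0 Ix)) indicE.
  have [xS|xS] := boolP (x \in shadow d a b); last by rewrite normr0 mulr0.
  rewrite normr1 mulr1; apply: le_trans (ler_norm _).
  rewrite ler_pdivlMl// mulrC -lee_fin fineK// TE// EFinM.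
  by apply: lee_wpmul2l; [rewrite lee_fin ltW// p0|apply: cle => //; exact: set_mem].
Qed.

(** At each point at most one f n is nonzero, so the modulus of the sum is the sum
    of the moduli; the rest is integration of a series with terms >= 0. *)
Lemma operator_disjoint_series (f g J : nat -> R -> R) (a : nat -> R) (x : R) :
  (forall n, measurable_fun [set: lebR R] (g n : lebR R -> R)) ->
  (forall n y, 0 <= g n y) ->
  (forall n y, f n y = g n y * (q y)^-1) ->
  (forall m n y, m <> n -> f m y != 0 -> f n y = 0) ->
  (forall n, (\int[leb R]_(t in ray I d x) (g n t)%:E = (J n x)%:E)%E) ->
  I x ->
  cvgn (series (fun n => `|a n| * (p x * J n x))) ->
  T (fun y => `|limn (series (fun n => a n * f n y))|) x
    = (limn (series (fun n => `|a n| * (p x * J n x))))%:E.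
Proof.
move=> mg g0 fE disj gJ Ix cx.
have mr : measurable (ray I d x : set (lebR R)) by exact: ray_measurable.
have J0 n : 0 <= J n x.
  by rewrite -lee_fin -gJ; apply: integral_ge0 => t _; rewrite lee_fin.
rewrite TE//.
have mE n : measurable_fun (ray I d x : set (lebR R)) (EFin \o (g n : lebR R -> R)).
  by apply/measurable_EFinP; exact: measurable_funS (mg n).
have maE n : measurable_fun (ray I d x : set (lebR R))
    (fun t : lebR R => ((`|a n|)%:E * (g n t)%:E)%E).
  exact: (measurable_funeM (`|a n|)%:E (mE n)).
have pointwise t : ray I d x t ->
    ((q t * `|limn (series (fun n => a n * f n t))|)%:E
      = \sum_(n <oo) ((`|a n|)%:E * (g n t)%:E))%E.
  move=> /ray_sub It; have qt := q0 It.
  have [n fn] := disjoint_pointwise_single t disj.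
  have gq k : g k t = q t * f k t by rewrite fE mulrCA divff ?mulr1// gt_eqF.
  have s1 : series (fun k => a k * f k t) @ \oo --> a n * f n t.
    by apply: (@cvg_series_single _ (fun k => a k * f k t)) => k /fn ->; rewrite mulr0.
  have s2 : series (fun k => `|a k| * g k t) @ \oo --> `|a n| * g n t.
    apply: (@cvg_series_single _ (fun k => `|a k| * g k t)) => k /fn fk.
    by rewrite gq fk !mulr0.
  under eq_eseriesr do rewrite -EFinM.
  rewrite nneseries_EFin; last exact: cvgP s2.
  rewrite (cvg_lim _ s1)// (cvg_lim _ s2)//; congr (_%:E).
  have f0 : 0 <= f n t by rewrite fE divr_ge0// ltW.
  by rewrite normrM (ger0_norm f0) gq mulrCA.
rewrite (eq_integral (fun t : lebR R =>
    \sum_(n <oo) ((`|a n|)%:E * (g n t)%:E))%E); last first.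
  by move=> t /set_mem; exact: pointwise.
rewrite (integral_nneseries (leb R) mr maE); last first.
  by move=> n t _; rewrite -EFinM lee_fin mulr_ge0.
rewrite (@eq_eseriesr _ _ (fun n => (`|a n| * J n x)%:E)); last first.
  move=> n _.
  have E0 t : ray I d x t -> (0 <= (EFin \o (g n : lebR R -> R)) t)%E.
    by move=> _; rewrite lee_fin.
  have /= -> := ge0_integralZl_EFin (leb R) mr E0 (mE n) (normr_ge0 (a n)).
  by rewrite gJ.
rewrite -nneseriesZl; last by move=> n _; rewrite lee_fin mulr_ge0.
rewrite -nneseries_EFin//; apply: eq_eseriesr => n _.
by rewrite -EFinM mulrCA.
Qed.

Lemma kernel_operator_copy (a b : R) :
  a < b -> `]a, b] `<=` I -> X (fun x => p x * \1_(shadow d a b) x) ->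
  order_asymptotically_isometric_copy_l1 I (derived_space I T X).
Proof.
move=> ab abI; set e := (fun x => _) => Xe.
have ba0 : 0 < b - a by rewrite subr_gt0.
pose phi x := p x * vol (ray I d x `&` `]a, b]).
have mab : measurable (`]a, b]%classic : set (lebR R)) by exact: leb_measurable_itv.
have indicSE x : \1_(shadow d a b) x = (x \in shadow d a b)%:R :> R.
  by rewrite indicE.
have e0 x : I x -> 0 <= e x by move=> /p0 /ltW px; rewrite mulr_ge0.
have phi0 x : I x -> 0 <= phi x.
  by move=> /p0 /ltW px; rewrite mulr_ge0// fine_ge0.
have vol_le_shadow x : vol (ray I d x `&` `]a, b]) <= (b - a) * \1_(shadow d a b) x.
  rewrite indicSE; have [xS|xS] := boolP (x \in _).
    have <- : vol `]a, b] = b - a by rewrite leb_itvoc// ltW.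
    rewrite mulr1; apply: vol_le => //.
    - by apply: measurableI => //; exact: ray_measurable.
    - exact: leb_itvoc_lty.
  by rewrite ray_off_shadow ?measure0 ?mulr0//; move: xS; rewrite notin_setE.
have Xphi : X phi.
  have [] // := bfs_ideal hX (f := phi) (g := (b - a) \*o e).
  - by apply: L0M => //; apply: vol_ray_L0 => //; exact: leb_itvoc_lty.
  - exact: (bfs_memZ hX).
  - apply: aeW => x Ix /=; rewrite (ger0_norm (phi0 x Ix)).
    rewrite ger0_norm; last by apply: mulr_ge0; [exact: ltW|exact: e0].
    rewrite /phi /e mulrCA; apply: ler_wpM2l; first by rewrite ltW// p0.
    exact: vol_le_shadow.
(* phi is positive at every interior point of ]a, b], so it is not null *)
have M0 : 0 < fnorm X phi.
  rewrite lt_neqAle (bfs_norm_ge0 hX)// andbT; apply/negP => /eqP/esym.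
  move=> /(bfs_norm_eq0 hX Xphi) ae0.
  pose m := (a + b) / 2.
  have am : a < m by rewrite /m; lra.
  have mb : m < b by rewrite /m; lra.
  have : (leb R).-negligible (`]a, m]%classic : set (lebR R)).
    apply: negligibleS ae0 => x; rewrite /= in_itv/= => /andP[ax xm] h.
    have xb : x < b by exact: le_lt_trans mb.
    have Ix : I x by apply: abI; rewrite /= in_itv/= ax ltW.
    have : 0 < phi x.
      by rewrite mulr_gt0 ?p0//; apply: vol_ray_gt0 => //; rewrite ax.
    by rewrite h// ltxx.
  move/negligibleP => /(_ (leb_measurable_itv _)) mu0.
  by have := leb_itvoc (ltW am); rewrite [X in X = _]mu0 => -[]; lra.
(* more than N tiles bring the error K h_n below M *)
pose N := Num.truncn (fnorm X e * (b - a) / fnorm X phi).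
have K0 : 0 <= fnorm X e by exact: (bfs_norm_ge0 hX).
have [g [J [mg g0 gab gdisj gJ]]] := @spread_densities R I d a b N mI ab abI.
pose del n : R := (b - a) / (N + n).+1%:R.
have del_gt0 n : 0 < del n by rewrite divr_gt0.
have J0 n x : 0 <= J n x.
  have [_ gJx _] := gJ n.
  by rewrite -lee_fin -gJx; apply: integral_ge0 => t _; rewrite lee_fin.
have fdisj m n x : m <> n -> g m x * (q x)^-1 != 0 -> g n x * (q x)^-1 = 0.
  by move=> mn; rewrite mulf_eq0 negb_or => /andP[/(gdisj _ _ _ mn) -> _]; rewrite mul0r.
apply: (@asymptotic_copy_of_l1 R I X T (fun n x => g n x * (q x)^-1)
  (fun n x => p x * J n x) phi e del (b - a)) => //.
- move=> n; rewrite del_gt0/= ler_pdivrMr// ler_peMr// ?ler1n//.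
  exact: ltW.
- have lim0 : (b - a) * harmonic n @[n --> \oo] --> (0 : R).
    rewrite -[X in _ --> X](mulr0 (b - a)); apply: cvgMl_tmp.
    exact: cvg_harmonic.
  apply: squeeze_cvgr lim0; last exact: cvg_cst.
  apply: nearW => n; rewrite (ltW (del_gt0 n))/=.
  apply: ler_wpM2l; first exact: ltW.
  by rewrite lef_pV2 ?posrE// ler_nat ltnS leq_addl.
- move=> n; rewrite mulrA ltr_pdivrMr// mulrC [ltRHS]mulrC -ltr_pdivrMr//.
  rewrite [(b - a) * _]mulrC; apply: lt_le_trans (truncnS_gt _) _.
  by rewrite ler_nat ltnS leq_addr.
- by move=> n; apply: L0M => //; have [] := gJ n.
- by move=> n x Ix; rewrite mulr_ge0// ltW// p0.
- move=> n x Ix; have [_ _ /(_ x) close] := gJ n.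
  rewrite -mulrBr normrM (gtr0_norm (p0 Ix)) mulrCA ler_pM2l ?p0//.
  apply: le_trans close _; apply: ler_wpM2l; first exact/ltW/(del_gt0 n).
  rewrite indicSE indicE ler_nat.
  have [xab|//] := boolP (x \in `]a, b]%classic).
  by rewrite (mem_set (@tile_sub_shadow R d a b x (set_mem xab))).
- move=> n; apply: L0M; last exact: L0V.
  exact: (@measurable_funS _ _ (lebR R) _ setT I _ _ _ (mg n)).
- move=> al x Ix cx; apply: operator_disjoint_series => //.
  by move=> n; have [_ /(_ x)] := gJ n.
Qed.

End kernel_operator.

(** * The Hardy operators *)

(** A tile and its ray share an end point and lie on opposite sides of it, so
    that every ray reaching the tile contains this one; and since the tile has to
    fit into I, the rays may miss one end point of I. *)
Lemma tiles_exhaust (R : realType) (I : set R) (d : bool) :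
  I = `[0, 1]%classic \/ I = `[0, +oo[%classic ->
  exists (a b : nat -> R) (z : R),
    (forall n, a n < b n /\ `]a n, b n] `<=` I) /\
    forall x, I x -> x <> z -> exists n, ray I d (if d then a n else b n) x.
Proof.
have inv_le (y : R) : 0 < y -> exists n, (n.+2%:R)^-1 <= y.
  move=> y0; exists (Num.truncn y^-1).
  rewrite -[leRHS]invrK lef_pV2 ?posrE ?invr_gt0//.
  apply: le_trans (ltW (truncnS_gt _)) _.
  by rewrite ler_nat.
have h0 n : 0 < (n.+2%:R : R)^-1 by rewrite invr_gt0.
have h1 n : (n.+2%:R : R)^-1 < 1 by rewrite invf_lt1// ltr1n.
case: d => -[->|->].
- exists (fun n => 1 - n.+2%:R^-1), (fun=> 1), 1; split => [n|x].
    move: (h0 n) (h1 n) => /=; move: (_^-1) => r r0 r1; split; first by lra.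
    by move=> t; rewrite /= !in_itv/=; lra.
  rewrite /= in_itv/= => /andP[x0 x1] /eqP xne.
  have x1' : 0 < 1 - x by rewrite subr_gt0 lt_neqAle xne.
  have [n hn] := inv_le _ x1'; exists n; split; rewrite /= in_itv/= ?x0 ?x1//.
  by move: hn; move: (_^-1) => r; lra.
- exists (fun n => n%:R), (fun n => n.+1%:R), 0; split => [n|x].
    split; first by rewrite ltr_nat.
    move=> t; rewrite /= !in_itv/= andbT => /andP[nt _].
    by rewrite (le_trans _ (ltW nt)).
  move=> Ix _; exists (Num.truncn x).+1; split => //.
  by rewrite /= in_itv/= ltW// truncnS_gt.
- exists (fun=> 0), (fun n => n.+2%:R^-1), 0; split => [n|x].
    move: (h0 n) (h1 n) => /=; move: (_^-1) => r r0 r1; split => //.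
    by move=> t; rewrite /= !in_itv/=; lra.
  rewrite /= in_itv/= => /andP[x0 x1] /eqP xne.
  have x0' : 0 < x by rewrite lt_neqAle eq_sym xne.
  have [n hn] := inv_le _ x0'; exists n; split; by rewrite /= in_itv/= ?andbT ?x0 ?x1.
- exists (fun=> 0), (fun n => n.+2%:R^-1), 0; split => [n|x].
    move: (h0 n) => /=; move: (_^-1) => r r0; split => // t.
    by rewrite /= !in_itv/= andbT; lra.
  rewrite /= in_itv/= andbT => x0 /eqP xne.
  have x0' : 0 < x by rewrite lt_neqAle eq_sym xne.
  have [n hn] := inv_le _ x0'; exists n; split; by rewrite /= in_itv/= ?andbT ?x0 ?x1.
Qed.

Lemma ray_base_sub (R : realType) (I : set R) (d : bool) (a b x : R) :
  shadow d a b x -> ray I d (if d then a else b) `<=` ray I d x.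
Proof.
rewrite /shadow; case: d; rewrite /= in_itv/= ?andbT => xS.
- exact: (le_ray I true (ltW xS)).
- exact: (le_ray I false xS).
Qed.

(** If all the rays of [tiles_exhaust] carried no mass of q |f|, then f would
    vanish almost everywhere. A ray of positive mass bounds the integrals from
    below on the shadow of the adjacent tile, because the rays of the shadow
    contain it. *)
Lemma positive_mass_tile (R : realType) (I : set R) (d : bool) (q f : R -> R) :
  I = `[0, 1]%classic \/ I = `[0, +oo[%classic ->
  L0 I q -> (forall x, I x -> 0 < q x) -> L0 I f ->
  ~ (\forall x \ae leb R, I x -> f x = 0) ->
  exists a b c : R, [/\ a < b, `]a, b] `<=` I, 0 < c &
    forall x, I x -> shadow d a b x ->
      (c%:E <= \int[leb R]_(t in ray I d x) (q t * `|f t|)%:E)%E].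
Proof.
move=> hI mq q0 mf fne.
have mI : measurable (I : set (lebR R)).
  by case: hI => ->; exact: leb_measurable_itv.
have mr x : measurable (ray I d x : set (lebR R)) by exact: ray_measurable.
have [a [b [z [abI cover]]]] := tiles_exhaust d hI.
pose F (t : lebR R) := (q t * `|f t|)%:E.
have mqf : L0 I (fun t => q t * `|f t|).
  by apply: L0M => //; exact: (measurableT_comp (@normr_measurable R setT) mf).
have mF : measurable_fun (I : set (lebR R)) F by exact/measurable_EFinP.
have F0 t : I t -> (0 <= F t)%E by move=> It; rewrite lee_fin mulr_ge0// ltW// q0.
pose y n := if d then a n else b n.
have [n Fn] : exists n, (\int[leb R]_(t in ray I d (y n)) F t != 0)%E.
  apply: contrapT => noF; apply: fne.
  have ae0 n : \forall t \ae leb R, ray I d (y n) t -> F t = 0%E.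
    have Fn : (\int[leb R]_(t in ray I d (y n)) F t = 0)%E.
      by apply/eqP/negPn/negP => Fn; apply: noF; exists n.
    apply/(ae_eq_integral_abs (leb R) (mr (y n))).
      by apply: measurable_funS mF => //; exact: ray_sub.
    rewrite -[RHS]Fn; apply: eq_integral => t /set_mem/ray_sub It.
    by rewrite gee0_abs// F0.
  have zne : \forall t \ae leb R, t <> z.
    exists [set z]; split.
    - by apply: leb_measurable_borel; exact: measurable_set1.
    - exact: (@lebesgue_measure_set1 R z).
    - by move=> t /= /contrapT.
  apply: (@filterS2 _ _ (ae_filter_ringOfSetsType (leb R)) _ _ _ _
    (ae_foralln ae0) zne) => t all0 tz It.
  have [n /all0[/eqP]] := cover t It tz.
  by rewrite mulf_eq0 gt_eqF ?q0//= normr_eq0 => /eqP.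
have mass_gt0 : (0 < \int[leb R]_(t in ray I d (y n)) F t)%E.
  rewrite lt_neqAle eq_sym Fn/=; apply: integral_ge0 => t /ray_sub; exact: F0.
have [c c0 cle] : exists2 c : R, 0 < c &
    (c%:E <= \int[leb R]_(t in ray I d (y n)) F t)%E.
  move: mass_gt0; case: (\int[leb R]_(t in _) _)%E => [r| |]//.
    by rewrite lte_fin => r0; exists r.
  by move=> _; exists 1; rewrite ?leey.
have [ab sub] := abI n; exists (a n), (b n), c; split => // x Ix xS.
apply: le_trans cle _; apply: ge0_subset_integral => //.
- by apply: measurable_funS mF => //; exact: ray_sub.
- by move=> t /ray_sub; exact: F0.
- exact: ray_base_sub.
Qed.

Theorem theorem8p2 (R : realType) (I : set R)
    (hI : I = `[0, 1]%classic \/ I = `[0, +oo[%classic)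
    (X : fspace R) (hX : banach_function_space I X)
    (w : R -> R) (hwm : L0 I w) (hw0 : forall x, I x -> 0 < w x)
    (T : (R -> R) -> R -> \bar R)
    (hT : T = hardy w \/ T = hardy_dual I w)
    (hTX : nontrivial I (derived_space I T X)) :
  order_asymptotically_isometric_copy_l1 I (derived_space I T X).
Proof.
have mI : measurable (I : set (lebR R)).
  by case: hI => ->; exact: leb_measurable_itv.
have m1 : L0 I (fun=> 1) by exact: (@measurable_cst _ _ (lebR R)).
have [d [p [q [mp mq p0 q0 TE]]]] : exists (d : bool) (p q : R -> R),
    [/\ L0 I p, L0 I q, forall x, I x -> 0 < p x, forall x, I x -> 0 < q x
      & forall (f : R -> R) x, I x -> T (fun t => `|f t|) x =
        ((p x)%:E * \int[leb R]_(t in ray I d x) (q t * `|f t|)%:E)%E].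
  case: hT => ->.
  - exists true, w, (fun=> 1); split => // f x Ix; rewrite /hardy.
    have -> : ray I true x = `[0, x]%classic.
      apply/seteqP; split => t; rewrite /ray/=.
        by case: hI => ->; rewrite /= !in_itv/= ?andbT => -[]; lra.
      case: hI Ix => ->; rewrite /= !in_itv/= ?andbT => Ix ?; split => //; lra.
    by under [in RHS]eq_integral do rewrite mul1r.
  - exists false, (fun=> 1), w; split => // f x Ix.
    by rewrite /hardy_dual mul1e.
have [f TXf fne] := hTX; have [mf _ _] := TXf.
have [a [b [c [ab abI c0 cle]]]] := positive_mass_tile d hI mq q0 mf fne.
apply: (kernel_operator_copy hX mI mp mq p0 q0 TE ab abI).
exact: (weight_on_shadow_mem hX mI mp p0 TE TXf c0 cle).
Qed.
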